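(* Let $(N_{II}(t))_{t\in\mathbb{N}_0}$ be a recurrent (type II) discrete-time renewal process, and let $\Delta T$ be a possibly defective stopping time with values in $\mathbb{N}\cup\{\infty\}$, independent of $N_{II}$, with $\psi_S(r)=\mathbb{P}[\Delta T=r]$ for $r\in\mathbb{N}$ and $\sum_{r=1}^{\infty}\psi_S(r)=\mathcal{Q}_S\in(0,1]$. Let $M(t)=N_{II}(t)$ for $t<\Delta T$ and $M(t)=N_{II}(\Delta T)$ for $t\ge\Delta T$, and set $$\Lambda_M=\lim_{m_0\to\infty}\lim_{t\to\infty}\mathbb{P}[M(t)>m_0].$$ Then $\Lambda_M=1-\mathcal{Q}_S$. Consequently: if $\Delta T$ is defective ($\mathcal{Q}_S<1$), then $M$ is an intermediate arrival process, which is never stopped with probability $\Lambda_M=1-\mathcal{Q}_S=\mathbb{P}[\Delta T=\infty]$; if $\Delta T$ is non-defective ($\mathcal{Q}_S=1$), then $\Lambda_M=0$, $M$ is stopped almost surely, and $M$ is of type I (transient).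
   Context: $\mathbb{N}=\{1,2,\dots\}$, $\mathbb{N}_0=\{0,1,2,\dots\}$. A recurrent (type II) discrete-time renewal process is $N_{II}(t)=\max\{n\ge 0: J_n\le t\}$, where $J_0=0$, $J_n=\sum_{j=1}^n\Delta t_j$, and the waiting times $\Delta t_j$ are IID, $\mathbb{N}$-valued and almost surely finite. A defective $\Delta T$ has missing mass $1-\mathcal{Q}_S=\mathbb{P}[\Delta T=\infty]$ at infinity; on $\{\Delta T=\infty\}$ one has $M(t)=N_{II}(t)$ for all $t$. An arrival process $\mathcal{N}(t)$ (integer-valued, non-decreasing paths, almost surely no simultaneous events), with $\mathcal{N}(\infty)=\lim_{t\to\infty}\mathcal{N}(t)$, is of type I (transient) if $\mathbb{P}[\mathcal{N}(\infty)<\infty]=1$, of type II (recurrent) if $\mathbb{P}[\mathcal{N}(\infty)=\infty]=1$, and intermediate if $\mathbb{P}[\mathcal{N}(\infty)<\infty]\in(0,1)$. The quantity $\lim_{m_0\to\infty}\lim_{t\to\infty}\mathbb{P}[\mathcal{N}(t)>m_0]$ equals $\mathbb{P}[\mathcal{N}(\infty)=\infty]$, the probability that the arrival process never stops. *)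

(* Defs.v *)
From mathcomp Require Import all_boot all_order all_algebra.
From mathcomp Require Import all_classical all_reals all_analysis.
From mathcomp Require Import measurable_realfun.

Set Implicit Arguments.
Unset Strict Implicit.
Unset Printing Implicit Defensive.

Import Order.TTheory GRing.Theory Num.Theory.
Import numFieldNormedType.Exports.

Local Open Scope classical_set_scope.
Local Open Scope ring_scope.

(* Random times with values in {1, 2, ...} or at infinity are represented as
   \bar R-valued random variables whose range is restricted as follows. *)
Definition pos_nat_or_infty (R : realType) (x : \bar R) : Prop :=
  x = +oo%E \/ exists2 r : nat, (0 < r)%N & x = r%:R%:E.

Definition mutually_independent d (T : measurableType d) (R : realType)
    (P : probability T R) d' (T' : measurableType d')
    (X : nat -> {RV P >-> T'}) : Prop :=
  forall (s : seq nat) (B : nat -> set T'), uniq s ->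
    (forall j, measurable (B j)) ->
    P (\bigcap_(j in [set` s]) (X j @^-1` B j)) =
    (\prod_(j <- s) P (X j @^-1` B j))%E.

Definition identically_distributed d (T : measurableType d) (R : realType)
    (P : probability T R) d' (T' : measurableType d')
    (X : nat -> {RV P >-> T'}) : Prop :=
  forall i j (B : set T'), measurable B ->
    distribution P (X i) B = distribution P (X j) B.

(* The waiting times are indexed from 0: the (j+1)-st one is dt j. *)
Definition renewal_epoch d (T : measurableType d) (R : realType)
    (P : probability T R) (dt : nat -> {RV P >-> \bar R}) (n : nat) (w : T)
    : \bar R :=
  (\sum_(j < n) dt j w)%E.

Definition is_max_nat (A : set nat) (n : nat) : Prop :=
  A n /\ forall m, A m -> (m <= n)%N.

Definition recurrent_renewal_process d (T : measurableType d) (R : realType)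
    (P : probability T R) (N : nat -> T -> nat) : Prop :=
  exists dt : nat -> {RV P >-> \bar R},
  [/\ mutually_independent dt,
      identically_distributed dt,
      forall j w, pos_nat_or_infty (dt j w),
      forall j, {ae P, forall w, (dt j w < +oo)%E} &
      forall t w,
        is_max_nat [set n | (renewal_epoch dt n w <= t%:R%:E)%E] (N t w)].

Definition process_sigma_algebra (T : Type) (X : nat -> T -> nat)
    : set (set T) :=
  <<s [set A | exists t (B : set nat), A = X t @^-1` B] >>.

Definition independent_of_process d (T : measurableType d) (R : realType)
    (P : probability T R) d' (T' : measurableType d')
    (S : {RV P >-> T'}) (X : nat -> T -> nat) : Prop :=
  forall (A : set T) (B : set T'), process_sigma_algebra X A -> measurable B ->
    (P (A `&` S @^-1` B) = P A * P (S @^-1` B))%E.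

(* In the second branch S w <= t; for the S considered here S w is then a
   natural number, and [Num.truncn (fine (S w))] is that number. *)
Definition stopped_process (T : Type) (R : realType) (N : nat -> T -> nat)
    (S : T -> \bar R) (t : nat) (w : T) : nat :=
  if (t%:R%:E < S w)%E then N t w else N (Num.truncn (fine (S w))) w.

(* X t w is the number of events up to and including time t, so that the
   number of events exactly at time 0 is X 0 w. *)
Definition arrival_process d (T : measurableType d) (R : realType)
    (P : probability T R) (X : nat -> T -> nat) : Prop :=
  [/\ forall t, measurable_fun setT (X t),
      forall w (s t : nat), (s <= t)%N -> (X s w <= X t w)%N &
      {ae P, forall w, (X 0%N w <= 1)%N /\
                       forall t, (X t.+1 w <= (X t w).+1)%N}].

Definition final_count (T : Type) (R : realType) (X : nat -> T -> nat) (w : T)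
    : \bar R :=
  limn (fun t => (X t w)%:R%:E : \bar R).

Definition eventually_stopped (T : Type) (R : realType) (X : nat -> T -> nat)
    : set T := [set w | (final_count R X w < +oo)%E].

Definition never_stopped (T : Type) (R : realType) (X : nat -> T -> nat)
    : set T := [set w | final_count R X w = +oo%E].

(* type I *)
Definition transient_arrival_process d (T : measurableType d) (R : realType)
    (P : probability T R) (X : nat -> T -> nat) : Prop :=
  arrival_process P X /\ P (eventually_stopped R X) = 1%E.

Definition intermediate_arrival_process d (T : measurableType d)
    (R : realType) (P : probability T R) (X : nat -> T -> nat) : Prop :=
  arrival_process P X /\ (0 < P (eventually_stopped R X) < 1)%E.

Definition tail_prob d (T : measurableType d) (R : realType)
    (P : probability T R) (X : nat -> T -> nat) (m0 t : nat) : \bar R :=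
  P [set w | (m0 < X t w)%N].

Definition Lambda d (T : measurableType d) (R : realType)
    (P : probability T R) (X : nat -> T -> nat) : \bar R :=
  limn (fun m0 => limn (tail_prob P X m0)).

(* Main.v *)
Require Import Defs.
From mathcomp Require Import all_boot all_order all_algebra.
From mathcomp Require Import all_classical all_reals all_analysis.
From mathcomp Require Import measurable_realfun.

Set Implicit Arguments.
Unset Strict Implicit.
Unset Printing Implicit Defensive.

Import Order.TTheory GRing.Theory Num.Theory.
Import numFieldNormedType.Exports.

Local Open Scope classical_set_scope.
Local Open Scope ring_scope.

(* On {DT = +oo} the stopped process is N, which is almost surely unbounded
   because all waiting times are almost surely finite; on {DT = r} it is bounded
   by N r.  Hence "M is never stopped" and {DT = +oo} agree up to a null set.
   Monotone continuity of P, from below in t and from above in m0, identifies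
   the iterated limit Lambda with P (never_stopped M). *)

(** * Renewal epochs and the counts they determine *)

Lemma ge1_pos_nat_or_infty (R : realType) (x : \bar R) :
  pos_nat_or_infty x -> (1 <= x)%E.
Proof.
case=> [->|[r r0 ->]]; first exact: leey.
by rewrite lee_fin ler1n.
Qed.

(** A preimage is a countable union of level sets, each the difference of two consecutive upper
    tails. Upper tails are the convenient test sets because for a renewal count they are events
    about a single epoch. *)
Lemma measurable_fun_nat_tail d (T : measurableType d) (X : T -> nat) :
  (forall n, measurable [set w | (n <= X w)%N]) -> measurable_fun setT X.
Proof.
move=> mX _ B _; rewrite setTI.
have -> : X @^-1` B = \bigcup_(n in B)
    ([set w | (n <= X w)%N] `\` [set w | (n.+1 <= X w)%N]).
  apply/seteqP; split=> w /=.
    by move=> BX; exists (X w) => //=; rewrite ltnn.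
  case=> n Bn /= [le_nX /negP]; rewrite -leqNgt => le_Xn.
  by have -> : X w = n by apply/eqP; rewrite eqn_leq le_Xn.
by apply: bigcup_measurable => n _; apply: measurableD.
Qed.

Lemma renewal_epochS d (T : measurableType d) (R : realType)
    (P : probability T R) (dt : nat -> {RV P >-> \bar R}) n w :
  renewal_epoch dt n.+1 w = (renewal_epoch dt n w + dt n w)%E.
Proof. by rewrite /renewal_epoch big_ord_recr. Qed.

Lemma renewal_epoch_nondecreasing d (T : measurableType d) (R : realType)
    (P : probability T R) (dt : nat -> {RV P >-> \bar R}) w :
  (forall j, pos_nat_or_infty (dt j w)) ->
  forall m n, (m <= n)%N -> (renewal_epoch dt m w <= renewal_epoch dt n w)%E.
Proof.
move=> hdt m n /subnK <-; elim: (n - m)%N => [//|k IH].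
rewrite addSn renewal_epochS; apply: (le_trans IH); apply: leeDl.
by apply: (@le_trans _ _ 1%E) => //; apply: ge1_pos_nat_or_infty.
Qed.

(** Epochs are nondecreasing, so the set being maximised is an initial segment of [nat]. This
    duality between counts and epochs is the only access to [N] used later. *)
Lemma renewal_count_ge d (T : measurableType d) (R : realType)
    (P : probability T R) (dt : nat -> {RV P >-> \bar R}) (t c n : nat) w :
  (forall j, pos_nat_or_infty (dt j w)) ->
  is_max_nat [set n | (renewal_epoch dt n w <= t%:R%:E)%E] c ->
  (n <= c)%N = (renewal_epoch dt n w <= t%:R%:E)%E.
Proof.
move=> hdt [hc cmax]; apply/idP/idP => [le_nc|]; last exact: cmax.
exact: le_trans (renewal_epoch_nondecreasing hdt le_nc) hc.
Qed.

Lemma renewal_epoch_bounded d (T : measurableType d) (R : realType)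
    (P : probability T R) (dt : nat -> {RV P >-> \bar R}) w n :
  (forall j, pos_nat_or_infty (dt j w)) -> (forall j, (dt j w < +oo)%E) ->
  exists t : nat, (renewal_epoch dt n w <= t%:R%:E)%E.
Proof.
move=> hdt fin; elim: n => [|n [t IH]].
  by exists 0%N; rewrite /renewal_epoch big_ord0.
case: (hdt n) => [Hn|[r _ Hn]]; first by have := fin n; rewrite Hn ltxx.
by exists (t + r)%N; rewrite renewal_epochS Hn natrD EFinD leeD2r.
Qed.

(** * Paths of the stopped process, final counts and the never-stopped event *)

Lemma stopped_process_infty (T : Type) (R : realType) (N : nat -> T -> nat)
    (S : T -> \bar R) t w :
  S w = +oo%E -> stopped_process N S t w = N t w.
Proof. by move=> Sw; rewrite /stopped_process Sw ltry. Qed.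

Lemma stopped_process_nat (T : Type) (R : realType) (N : nat -> T -> nat)
    (S : T -> \bar R) t (r : nat) w :
  S w = r%:R%:E -> stopped_process N S t w = N (minn t r) w.
Proof.
move=> Sw; rewrite /stopped_process Sw lte_fin ltr_nat /= natrK.
by rewrite /minn; case: ifP.
Qed.

Lemma final_count_fin (T : Type) (R : realType) (X : nat -> T -> nat) w :
  (forall s t, (s <= t)%N -> (X s w <= X t w)%N) ->
  (final_count R X w < +oo)%E <-> exists m, forall t, (X t w <= m)%N.
Proof.
move=> ndX; rewrite /final_count.
have nd : nondecreasing_seq (fun t => (X t w)%:R%:E : \bar R).
  by move=> s t st; rewrite lee_fin ler_nat ndX.
rewrite (cvg_lim _ (ereal_nondecreasing_cvgn nd))//.
set S := ereal_sup _.
have leS t : ((X t w)%:R%:E <= S)%E by apply: ereal_sup_ubound; exists t.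
split=> [Slt|[m hm]].
  (* Nonnegativity excludes [-oo], so the supremum is a real; as counts are integers, its truncation
     still bounds them. *)
  have S0 : (0 <= S)%E by apply: le_trans (leS 0%N); rewrite lee_fin.
  case: S Slt leS S0 => // s _ leS s0; exists (Num.truncn s) => t.
  by rewrite truncn_ge_nat // -lee_fin leS.
apply: (@le_lt_trans _ _ m%:R%:E); last exact: ltry.
by apply: ge_ereal_sup => _ [t _ <-]; rewrite lee_fin ler_nat.
Qed.

(** The countable form gives measurability, and its nesting, union over [t] inside intersection over
    [m], mirrors the iterated limit in [Lambda]. *)
Lemma never_stoppedE (T : Type) (R : realType) (X : nat -> T -> nat) :
  (forall w s t, (s <= t)%N -> (X s w <= X t w)%N) ->
  never_stopped R X = \bigcap_m \bigcup_t [set w | (m < X t w)%N].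
Proof.
move=> ndX; apply/seteqP; split=> w /=.
  rewrite /never_stopped /= => oo m _; apply: contrapT => Hm.
  suff : (final_count R X w < +oo)%E by rewrite oo ltxx.
  apply/final_count_fin; first exact: ndX.
  by exists m => t; rewrite leqNgt; apply/negP => lt; apply: Hm; exists t.
move=> H; rewrite /never_stopped /=; apply/eqP; rewrite eq_le leey /= leNgt.
apply/negP => /final_count_fin; case; first exact: ndX.
by move=> m hm; have [t _ /=] := H m I; rewrite ltnNge hm.
Qed.

Lemma eventually_stoppedE (T : Type) (R : realType) (X : nat -> T -> nat) :
  eventually_stopped R X = ~` never_stopped R X.
Proof.
rewrite /eventually_stopped /never_stopped; apply/seteqP; split=> w /=.
  by move=> /[swap] ->; rewrite ltxx.
by move=> /eqP; rewrite ltey.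
Qed.

Lemma measurable_tail_event d (T : measurableType d) (X : nat -> T -> nat) m t :
  measurable_fun setT (X t) -> measurable [set w | (m < X t w)%N].
Proof.
move=> mX; rewrite -[X in measurable X]setTI.
exact: (mX _ [set n | (m < n)%N]).
Qed.

Lemma measurable_never_stopped d (T : measurableType d) (R : realType)
    (X : nat -> T -> nat) :
  (forall t, measurable_fun setT (X t)) ->
  (forall w s t, (s <= t)%N -> (X s w <= X t w)%N) ->
  measurable (never_stopped R X).
Proof.
move=> mX ndX; rewrite never_stoppedE//; apply: bigcap_measurableType => m _.
by apply: bigcup_measurable => t _; exact: measurable_tail_event.
Qed.

(** * The iterated limit by monotone continuity of [P] *)

Lemma tail_prob_cvg d (T : measurableType d) (R : realType)
    (P : probability T R) (X : nat -> T -> nat) m0 :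
  (forall t, measurable_fun setT (X t)) ->
  (forall w s t, (s <= t)%N -> (X s w <= X t w)%N) ->
  tail_prob P X m0 @ \oo --> P (\bigcup_t [set w | (m0 < X t w)%N]).
Proof.
move=> mX ndX.
apply: (nondecreasing_cvg_mu (F := fun t => [set w | (m0 < X t w)%N])).
- by move=> t; exact: measurable_tail_event.
- by apply: bigcup_measurable => t _; exact: measurable_tail_event.
- move=> s t st; apply/subsetPset => w /= lt.
  exact: leq_trans lt (ndX _ _ _ st).
Qed.

Lemma lim_tail_prob_cvg d (T : measurableType d) (R : realType)
    (P : probability T R) (X : nat -> T -> nat) :
  (forall t, measurable_fun setT (X t)) ->
  (forall w s t, (s <= t)%N -> (X s w <= X t w)%N) ->
  (fun m0 => limn (tail_prob P X m0)) @ \oo --> P (never_stopped R X).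
Proof.
move=> mX ndX.
pose F m := \bigcup_t [set w | (m < X t w)%N].
have mF m : measurable (F m).
  by apply: bigcup_measurable => t _; exact: measurable_tail_event.
have -> : (fun m0 => limn (tail_prob P X m0)) = P \o F.
  by apply/funext => m; apply: cvg_lim => //; exact: tail_prob_cvg.
rewrite never_stoppedE//; apply: nonincreasing_cvg_mu => //.
(* Continuity from above needs a set of finite measure at the start. *)
- by apply: le_lt_trans (probability_le1 P _) _ => //; rewrite ltry.
- exact: bigcap_measurableType.
- move=> m n mn; apply/subsetPset => w [t _ /= lt]; exists t => //=.
  exact: leq_ltn_trans mn lt.
Qed.

(** Everything is read off from epochs. Only unboundedness is almost sure: an infinite waiting time
    would freeze the count. *)
Lemma recurrent_renewal_arrival d (T : measurableType d) (R : realType)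
    (P : probability T R) (N : nat -> T -> nat) :
  recurrent_renewal_process P N ->
  [/\ forall t, measurable_fun setT (N t),
      forall w s t, (s <= t)%N -> (N s w <= N t w)%N,
      forall w, N 0%N w = 0%N,
      forall w t, (N t.+1 w <= (N t w).+1)%N &
      {ae P, forall w, forall m, exists t, (m < N t w)%N}].
Proof.
case=> dt [_ _ hdt fin hN].
have geN t n w : (n <= N t w)%N = (renewal_epoch dt n w <= t%:R%:E)%E.
  exact: renewal_count_ge.
have stepN n w : (renewal_epoch dt n w + 1 <= renewal_epoch dt n.+1 w)%E.
  by rewrite renewal_epochS leeD2l// ge1_pos_nat_or_infty.
split.
- move=> t; apply: measurable_fun_nat_tail => n.
  under eq_set do rewrite geN.
  rewrite -[X in measurable X]setTI; apply: emeasurable_fun_infty_c => //.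
  exact: emeasurable_sum.
- move=> w s t st; rewrite geN.
  have := leqnn (N s w); rewrite geN => /le_trans; apply.
  by rewrite lee_fin ler_nat.
- move=> w; apply/eqP; rewrite -leqn0 leqNgt geN -ltNge.
  apply: (lt_le_trans _ (stepN 0%N w)).
  by rewrite /renewal_epoch big_ord0 add0e lte_fin.
(* If epoch [n.+1] is at most [t.+1], unit spacing puts epoch [n] at or before [t]. *)
- move=> w t; case E: (N t.+1 w) => [//|n]; rewrite ltnS geN.
  have : (n.+1 <= N t.+1 w)%N by rewrite E.
  rewrite geN => /(le_trans (stepN n w)).
  by rewrite -natr1 EFinD leeD2rE.
(* Countably many null sets merge into one, off which every epoch is finite and hence below some
   natural time. *)
- have : {ae P, forall w, forall j, (dt j w < +oo)%E}.
    by apply: ae_foralln => j; exact: fin.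
  apply: filterS => w finw m.
  have [t ht] := renewal_epoch_bounded m.+1 (fun j => hdt j w) finw.
  by exists t; rewrite geN.
Qed.

(** * Regularity of the stopped process *)

Lemma stopped_process_nondecreasing (T : Type) (R : realType)
    (N : nat -> T -> nat) (S : T -> \bar R) :
  (forall w, pos_nat_or_infty (S w)) ->
  (forall w s t, (s <= t)%N -> (N s w <= N t w)%N) ->
  forall w s t, (s <= t)%N ->
    (stopped_process N S s w <= stopped_process N S t w)%N.
Proof.
move=> hS ndN w s t st; case: (hS w) => [Sw|[r _ Sw]].
  by rewrite !stopped_process_infty// ndN.
by rewrite !(stopped_process_nat _ _ Sw) ndN// leq_min geq_minr geq_min st.
Qed.

Lemma stopped_process_measurable d (T : measurableType d) (R : realType)
    (N : nat -> T -> nat) (S : T -> \bar R) t :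
  (forall w, pos_nat_or_infty (S w)) -> measurable_fun setT S ->
  (forall t, measurable_fun setT (N t)) ->
  measurable_fun setT (stopped_process N S t).
Proof.
move=> hS mS mN _ B mB; rewrite setTI.
have mNB s : measurable (N s @^-1` B).
  by rewrite -[X in measurable X]setTI; exact: mN.
have mSB A : measurable A -> measurable (S @^-1` A).
  by move=> mA; rewrite -[X in measurable X]setTI; exact: mS.
(* Splitting over the countably many values of [S] replaces the random index by the deterministic
   indices [t] and [minn t r]. *)
have -> : stopped_process N S t @^-1` B =
    (S @^-1` [set +oo%E] `&` N t @^-1` B) `|`
    \bigcup_r (S @^-1` [set r%:R%:E] `&` N (minn t r) @^-1` B).
  apply/seteqP; split=> w /=.
    case: (hS w) => [Sw|[r _ Sw]].
      by rewrite stopped_process_infty//; left.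
    by rewrite (stopped_process_nat _ _ Sw); right; exists r.
  case=> [[Sw]|[r _ /= [Sw]]]; first by rewrite stopped_process_infty.
  by rewrite (stopped_process_nat _ _ Sw).
apply: measurableU.
  by apply: measurableI => //; apply: mSB; exact: emeasurable_set1.
apply: bigcup_measurable => r _.
by apply: measurableI => //; apply: mSB; exact: emeasurable_set1.
Qed.

Lemma stopped_process_step (T : Type) (R : realType)
    (N : nat -> T -> nat) (S : T -> \bar R) t w :
  pos_nat_or_infty (S w) ->
  (forall t, (N t.+1 w <= (N t w).+1)%N) ->
  (stopped_process N S t.+1 w <= (stopped_process N S t w).+1)%N.
Proof.
move=> [Sw|[r _ Sw]] stepN; first by rewrite !stopped_process_infty.
rewrite !(stopped_process_nat _ _ Sw).
case: (ltnP t r) => [tr|rt]; first by rewrite (minn_idPl tr).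
by rewrite (minn_idPr (leqW rt)).
Qed.

(** * Missing mass and the probability of never stopping *)

Lemma probability_infty d (T : measurableType d) (R : realType)
    (P : probability T R) (S : {RV P >-> \bar R}) :
  (forall w, pos_nat_or_infty (S w)) ->
  (P (S @^-1` [set +oo]) = 1 - \sum_(1 <= r <oo) P (S @^-1` [set r%:R%:E]))%E.
Proof.
move=> hS; pose F (r : nat) := S @^-1` [set r%:R%:E].
have mF r : measurable (F r) by exact: measurable_funPTI.
have -> : S @^-1` [set +oo%E] = ~` (\bigcup_(r in [set r | (1 <= r)%N]) F r).
  apply/seteqP; split=> w /=.
    by move=> Sw [r _ Fw]; have := etrans (esym Sw) Fw.
  by move=> nF; case: (hS w) => // -[r r0 Sw]; case: nF; exists r.
rewrite probability_setC; last by apply: bigcup_measurable.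
rewrite measure_bigcup//; last first.
  move=> r s _ _ [w [Fr Fs]]; have [/eqP] := etrans (esym Fr) Fs.
  by rewrite eqr_nat => /eqP.
(* The lower summation bound 1 becomes a condition on the index, matching the union over
   [1 <= r]. *)
congr (1 - _)%E; rewrite [RHS]eseries_cond; apply: eq_eseriesl => i.
by apply/idP/idP; rewrite inE.
Qed.

Lemma probability_never_stopped d (T : measurableType d) (R : realType)
    (P : probability T R) (N : nat -> T -> nat) (S : {RV P >-> \bar R}) :
  (forall t, measurable_fun setT (N t)) ->
  (forall w s t, (s <= t)%N -> (N s w <= N t w)%N) ->
  {ae P, forall w, forall m, exists t, (m < N t w)%N} ->
  (forall w, pos_nat_or_infty (S w)) ->
  P (never_stopped R (stopped_process N S)) = P (S @^-1` [set +oo%E]).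
Proof.
move=> mN ndN [Z [mZ PZ0 subZ]] hS.
have ndM := stopped_process_nondecreasing hS ndN.
have mE : measurable (never_stopped R (stopped_process N S)).
  by apply: measurable_never_stopped => // t; exact: stopped_process_measurable.
have mD : measurable (S @^-1` [set +oo%E]).
  by apply: measurable_funPTI; exact: emeasurable_set1.
apply/eqP; rewrite eq_le; apply/andP; split.
  apply: le_measure; rewrite ?inE// => w.
  rewrite never_stoppedE// => Ew; case: (hS w) => // -[r _ Sw].
  (* On [S w = r] no count exceeds [N r w], so this level cannot be passed. *)
  have [t _ /=] := Ew (N r w) I.
  by rewrite (stopped_process_nat _ _ Sw) ltnNge ndN// geq_minr.
(* The converse inclusion can fail on the null set [Z] where [N] may stay bounded; adjoining [Z]
   costs no probability. *)
rewrite -(measureU0 mE mZ PZ0); apply: le_measure; rewrite ?inE//.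
  exact: measurableU.
move=> w /= Sw; have [Hw|nHw] := pselect (forall m, exists t, (m < N t w)%N).
  left; rewrite never_stoppedE// => m _; have [t ht] := Hw m.
  by exists t => //=; rewrite stopped_process_infty.
by right; exact: subZ.
Qed.

Theorem mainTheorem4 (d : measure_display) (T : measurableType d)
    (R : realType) (P : probability T R)
    (N : nat -> T -> nat) (hN : recurrent_renewal_process P N)
    (DT : {RV P >-> \bar R}) (hDT : forall w, pos_nat_or_infty (DT w))
    (hind : independent_of_process DT N)
    (psi : nat -> R)
    (hpsi : forall r : nat, (0 < r)%N ->
       P (DT @^-1` [set r%:R%:E]) = (psi r)%:E)
    (Q : R) (hQ : (\sum_(1 <= r <oo) (psi r)%:E = Q%:E)%E)
    (hQ01 : 0 < Q <= 1)
    (M : nat -> T -> nat) (hM : M = stopped_process N DT) :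
  [/\ forall m0, cvgn (tail_prob P M m0),
      cvgn (fun m0 => limn (tail_prob P M m0)) &
      Lambda P M = (1 - Q)%:E] /\
  (Q < 1 ->
     [/\ intermediate_arrival_process P M,
         P (never_stopped R M) = Lambda P M,
         Lambda P M = (1 - Q)%:E &
         (1 - Q)%:E = P (DT @^-1` [set +oo%E])]) /\
  (Q = 1 ->
     [/\ Lambda P M = 0%E,
         {ae P, forall w, eventually_stopped R M w} &
         transient_arrival_process P M]).
Proof.
have [mN ndN N0 stepN recN] := recurrent_renewal_arrival hN.
have mM t : measurable_fun setT (M t).
  by rewrite hM; exact: stopped_process_measurable.
have ndM : forall w s t, (s <= t)%N -> (M s w <= M t w)%N.
  by rewrite hM; exact: stopped_process_nondecreasing.
have Pinf : P (DT @^-1` [set +oo%E]) = (1 - Q)%:E.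
  rewrite probability_infty// EFinB -hQ; congr (1 - _)%E.
  (* [hpsi] speaks of positive [r] only, so the series are compared through partial sums, whose
     index range supplies [0 < r]. *)
  apply: congr_lim; apply/funext => n.
  by apply: eq_big_nat => r /andP[r0 _]; exact: hpsi.
have Pnever : P (never_stopped R M) = (1 - Q)%:E.
  by rewrite hM probability_never_stopped.
have PM := lim_tail_prob_cvg (P := P) mM ndM.
have LM : Lambda P M = (1 - Q)%:E by rewrite -Pnever; exact: cvg_lim PM.
have mnever : measurable (never_stopped R M) by exact: measurable_never_stopped.
have Pstop : P (eventually_stopped R M) = Q%:E.
  by rewrite eventually_stoppedE probability_setC// Pnever -EFinB subKr.
have arrM : arrival_process P M.
  split=> //; apply: aeW => w; split=> [|t].
    rewrite hM; case: (hDT w) => [Sw|[r r0 Sw]].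
      by rewrite stopped_process_infty// N0.
    by rewrite (stopped_process_nat _ _ Sw) min0n N0.
  by rewrite hM; exact: stopped_process_step.
split; [split|split].
- move=> m0; apply/cvg_ex.
  exists (P (\bigcup_t [set w | (m0 < M t w)%N])); exact: tail_prob_cvg.
- by apply/cvg_ex; exists (P (never_stopped R M)).
- exact: LM.
- move=> Q1; split; rewrite ?LM ?Pnever ?Pinf//.
  by split=> //; rewrite Pstop !lte_fin Q1; case/andP: hQ01 => ->.
- move=> Q1; split; first by rewrite LM Q1 subrr.
  (* The never-stopped event itself serves as the exceptional set: its probability is [1 - Q], here
     0. *)
  + exists (never_stopped R M); split=> //; first by rewrite Pnever Q1 subrr.
    by move=> w /=; rewrite eventually_stoppedE => /contrapT.
  + by split=> //; rewrite Pstop Q1.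
Qed.
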